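(* Let $\mathcal{H}$ be a complex separable Hilbert space, and let $\mathcal{A}$ be a $C^*$-subalgebra of the algebra $\mathcal{B}_0(\mathcal{H})$ of compact operators on $\mathcal{H}$. Then every closed semiregular operator on $\mathcal{A}$ is regular.
   Context: A $C^*$-algebra $\mathcal{A}$ is viewed as a Hilbert module over itself with $\langle a,b\rangle=a^*b$. An operator $T$ on $\mathcal{A}$ is a linear map from a linear subspace $D(T)\subseteq\mathcal{A}$ to $\mathcal{A}$; its adjoint (for $D(T)$ dense) has domain $D(T^* )=\{y\in\mathcal{A}:\exists z\in\mathcal{A},\ \langle Tx,y\rangle=\langle x,z\rangle\ \forall x\in D(T)\}$ and $T^*y=z$. $T$ is semiregular if (a) $D(T)$ is a dense right submodule (right ideal) of $\mathcal{A}$, (b) $T$ is closable, (c) $T^*$ is densely defined. $T$ is regular if it is a closed semiregular operator such that the range of $I+T^*T$ is dense in $\mathcal{A}$, where $D(T^*T)=\{x\in D(T):Tx\in D(T^* )\}$. *)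

(* Defs.v *)
From HB Require Import structures.
From mathcomp Require Import all_boot all_order all_algebra.
From mathcomp Require Import sesquilinear complex.
From mathcomp Require Import all_classical all_reals all_analysis.

Set Implicit Arguments.
Unset Strict Implicit.
Unset Printing Implicit Defensive.

Import Order.TTheory GRing.Theory Num.Theory.
Import numFieldNormedType.Exports.

Local Open Scope classical_set_scope.
Local Open Scope complex_scope.
Local Open Scope ring_scope.

(* B(V): bounded linear operators on a complex normed space, with the pointwise
   vector space structure, composition as product and the operator norm. *)
Section BoundedOperators.
Variables (R : realType) (V : normedModType R[i]).

Definition bounded_linear : {pred V -> V} := fun f =>
  `[< linear f /\ exists M : R[i], forall x, `|f x| <= M * `|x| >].

Lemma bounded_linear_submod : submod_closed bounded_linear.
Proof.
split=> [|a f g]; rewrite ?inE.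
- split=> [b x y|]; first by rewrite /= scaler0 addr0.
  by exists 0 => x; rewrite normr0 mul0r.
- move=> [lf [M fM]] [lg [N gN]]; split=> [b x y|].
  rewrite /= !fctE /= lf lg !scalerDr !scalerA addrACA; congr (_ + _).
    by rewrite mulrC.
  exists (`|a| * M + N) => x; rewrite (le_trans (ler_normD _ _))// mulrDl lerD//.
  by rewrite normrZ -mulrA ler_wpM2l.
Qed.

HB.instance Definition _ := GRing.isSubmodClosed.Build R[i] (V -> V)
  bounded_linear bounded_linear_submod.

Record bop := Bop { bop_val :> V -> V; bop_valP : bop_val \in bounded_linear }.

HB.instance Definition _ := [isSub for bop_val].
HB.instance Definition _ := gen_eqMixin bop.
HB.instance Definition _ := gen_choiceMixin bop.
HB.instance Definition _ := [SubChoice_isSubLmodule of bop by <:].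

Lemma bopP (f g : bop) : f =1 g -> f = g.
Proof. by move=> fg; apply/val_inj/funext. Qed.

Lemma bop_linear (f : bop) : linear f.
Proof. by have := bop_valP f; rewrite inE => -[]. Qed.

HB.instance Definition _ (f : bop) :=
  GRing.isLinear.Build R[i] V V *:%R f (bop_linear f).

Lemma bop_bounded (f : bop) : exists2 M : R[i],
  0 <= M & forall x, `|f x| <= M * `|x|.
Proof.
have := bop_valP f; rewrite inE => -[_ [M fM]].
exists `|M| => // x; rewrite -[X in _ * X]normr_id -normrM ger0_norm//.
exact: le_trans (fM x).
Qed.

Lemma bop_one_subproof : (@id V) \in bounded_linear.
Proof. by rewrite inE; split=> //; exists 1 => x; rewrite mul1r. Qed.

Lemma bop_mul_subproof (f g : bop) : f \o g \in bounded_linear.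
Proof.
rewrite inE; split=> [a x y|] /=; first by rewrite !linearP.
have [M M0 fM] := bop_bounded f; have [N N0 gN] := bop_bounded g.
exists (M * N) => x; rewrite -mulrA (le_trans (fM _))//.
by rewrite ler_wpM2l.
Qed.

Definition bop_one : bop := Bop bop_one_subproof.
Definition bop_mul (f g : bop) : bop := Bop (bop_mul_subproof f g).

Lemma bop_mulA : associative bop_mul.
Proof. by move=> f g h; exact: bopP. Qed.
Lemma bop_mul1l : left_id bop_one bop_mul.
Proof. by move=> f; exact: bopP. Qed.
Lemma bop_mul1r : right_id bop_one bop_mul.
Proof. by move=> f; exact: bopP. Qed.
Lemma bop_mulDl : left_distributive bop_mul +%R.
Proof. by move=> f g h; exact: bopP. Qed.
Lemma bop_mulDr : right_distributive bop_mul +%R.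
Proof. by move=> f g h; apply: bopP => x; rewrite /= linearD. Qed.

HB.instance Definition _ := GRing.Zmodule_isPzRing.Build bop
  bop_mulA bop_mul1l bop_mul1r bop_mulDl bop_mulDr.

(* Norms over R[i] take their (real) values in R[i], hence the real part. *)
Definition opnorm (f : bop) : R :=
  sup [set complex.Re `|f x| | x in [set x : V | `|x| <= 1]].

Let ReE (x : V) : (complex.Re `|x|)%:C = `|x|.
Proof. by rewrite RRe_real. Qed.

Let opnorm_has_sup (f : bop) :
  has_sup [set complex.Re `|f x| | x in [set x : V | `|x| <= 1]].
Proof.
split; first by exists (complex.Re `|f 0|), 0 => //=; rewrite normr0.
have [M M0 fM] := bop_bounded f.
exists (complex.Re M) => _ [x /= x1 <-].
rewrite -lecR ReE RRe_real ?ger0_real// (le_trans (fM x))//.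
by rewrite ler_piMr.
Qed.

Lemma le_opnorm (f : bop) (x : V) : `|f x| <= (opnorm f)%:C * `|x|.
Proof.
have [->|x0] := eqVneq x 0; first by rewrite linear0 !normr0 mulr0.
rewrite -ler_pdivrMr ?normr_gt0//.
have nx : `|(`|x|^-1)| = `|x|^-1 by rewrite ger0_norm// invr_ge0.
have -> : `|f x| / `|x| = `|f (`|x|^-1 *: x)|.
  by rewrite linearZ/= normrZ nx mulrC.
rewrite -ReE lecR; apply: ub_le_sup; first by have [] := opnorm_has_sup f.
by exists (`|x|^-1 *: x) => //=; rewrite normrZ nx mulVf// normr_eq0.
Qed.

Lemma opnorm_le (f : bop) (M : R) :
  (forall x, `|x| <= 1 -> `|f x| <= M%:C) -> opnorm f <= M.
Proof.
move=> fM; apply: ge_sup; first by have [] := opnorm_has_sup f.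
by move=> _ [x /= x1 <-]; rewrite -lecR ReE fM.
Qed.

Let opnorm_ge0 (f : bop) : 0 <= opnorm f.
Proof.
apply: ub_le_sup; first by have [] := opnorm_has_sup f.
by exists 0 => /=; rewrite ?linear0 normr0.
Qed.

Let opnormD (f g : bop) :
  (opnorm (f + g))%:C <= (opnorm f)%:C + (opnorm g)%:C.
Proof.
rewrite -rmorphD lecR; apply: opnorm_le => x x1 /=.
rewrite (le_trans (ler_normD _ _))// rmorphD/= lerD//.
  by rewrite (le_trans (le_opnorm f x))// ler_piMr// lecR.
by rewrite (le_trans (le_opnorm g x))// ler_piMr// lecR.
Qed.

Let opnormZ_le (a : R[i]) (f : bop) :
  (opnorm (a *: f))%:C <= `|a| * (opnorm f)%:C.
Proof.
have aE : `|a| = (complex.Re `|a|)%:C by rewrite RRe_real.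
rewrite aE -rmorphM lecR; apply: opnorm_le => x x1.
rewrite rmorphM /= -aE normrZ ler_wpM2l// (le_trans (le_opnorm f x))//.
by rewrite ler_piMr// lecR.
Qed.

Let opnormZ (a : R[i]) (f : bop) :
  (opnorm (a *: f))%:C = `|a| * (opnorm f)%:C.
Proof.
apply/eqP; rewrite eq_le opnormZ_le /=.
have [->|a0] := eqVneq a 0; first by rewrite normr0 mul0r lecR.
rewrite -ler_pdivlMl ?normr_gt0// -normfV.
by rewrite (le_trans _ (opnormZ_le _ _))// scalerA mulVf// scale1r.
Qed.

Let opnorm_eq0 (f : bop) : (opnorm f)%:C = 0 -> f = 0.
Proof.
move=> f0; apply: bopP => x; apply/eqP; rewrite -normr_le0.
by rewrite (le_trans (le_opnorm f x))// f0 mul0r.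
Qed.

HB.instance Definition _ := Lmodule_isNormed.Build R[i] bop
  opnormD opnormZ opnorm_eq0.

Lemma bop_normE (f : bop) : `|f| = (opnorm f)%:C. Proof. by []. Qed.

End BoundedOperators.

(* Hilbert-space adjoint of a bounded operator; the defining set is a singleton
   by the Riesz representation theorem. *)
Definition bop_adj (R : realType) (H : completeNormedModType R[i])
    (ip : {dot H for @Num.conj R[i]}) (f : bop H) : bop H :=
  xget (0 : bop H) [set g | forall x y, ip (f x) y = ip x (g y)].

Definition compact_operator (R : realType) (H : completeNormedModType R[i])
    (f : bop H) :=
  precompact (f @` [set x | `|x| <= 1]).

Section CstarSubalgebra.
Context (R : realType) (H : completeNormedModType R[i]).
Variable ip : {dot H for @Num.conj R[i]}.

Record cstar_subalgebra (A : set (bop H)) : Prop := CstarSubalgebra {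
  cstar_linear : submod_closed (mem A) ;
  cstar_mul : forall a b, A a -> A b -> A (a * b) ;
  cstar_adj : forall a, A a -> A (bop_adj ip a) ;
  cstar_closed : closed A }.

End CstarSubalgebra.

(* Partially defined maps; the values of [pfun] outside [pdom] are irrelevant. *)
Record partial_op (T : Type) := PartialOp { pdom : set T; pfun :> T -> T }.

Definition pgraph (T : Type) (t : partial_op T) : set (T * T) :=
  [set p | pdom t p.1 /\ p.2 = t p.1].

(* Unbounded operators on the C*-algebra A, a Hilbert module over itself with
   <a, b> = a^* b.  As A is closed in B(H) and carries the norm of B(H),
   closures and closed sets computed in B(H) are those of A. *)
Section Operators.
Context (R : realType) (H : completeNormedModType R[i]).
Variable ip : {dot H for @Num.conj R[i]}.
Variable A : set (bop H).
Implicit Types t s : partial_op (bop H).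

Definition module_ip (a b : bop H) : bop H := bop_adj ip a * b.

Record operator_on t : Prop := OperatorOn {
  op_domS : pdom t `<=` A ;
  op_domL : submod_closed (mem (pdom t)) ;
  op_maps : forall x, pdom t x -> A (t x) ;
  op_linear : forall (a : R[i]) x y, pdom t x -> pdom t y ->
    t (a *: x + y) = a *: t x + t y }.

Definition dense_in (D : set (bop H)) := A `<=` closure D.

Definition op_closed t := closed (pgraph t).

Definition op_closable t :=
  exists s, [/\ operator_on s, op_closed s & pgraph t `<=` pgraph s].

(* For y in its domain, T^* y is the z with <T x, y> = <x, z> on D(T); it is
   unique when D(T) is dense. *)
Definition adjoint_spec t (y z : bop H) :=
  A z /\ forall x, pdom t x -> module_ip (t x) y = module_ip x z.

Definition op_adj t : partial_op (bop H) :=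
  PartialOp [set y | A y /\ exists z, adjoint_spec t y z]
            (fun y => xget (0 : bop H) [set z | adjoint_spec t y z]).

Definition op_comp s t : partial_op (bop H) :=
  PartialOp [set x | pdom t x /\ pdom s (t x)] (fun x => s (t x)).

Record semiregular t : Prop := Semiregular {
  sr_op : operator_on t ;
  sr_dense : dense_in (pdom t) ;
  sr_ideal : forall x a, pdom t x -> A a -> pdom t (x * a) ;
  sr_closable : op_closable t ;
  sr_adj_dense : dense_in (pdom (op_adj t)) }.

Record regular t : Prop := Regular {
  reg_closed : op_closed t ;
  reg_semiregular : semiregular t ;
  reg_range : dense_in
    [set x + op_comp (op_adj t) t x | x in pdom (op_comp (op_adj t) t)] }.

End Operators.

(* Main.v *)
Require Import Defs.
From mathcomp Require Import all_boot all_order all_algebra.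
From mathcomp Require Import sesquilinear complex.
From mathcomp Require Import all_classical all_reals all_analysis.
From mathcomp Require Import ring lra.
Import Order.TTheory GRing.Theory Num.Theory.
Import numFieldNormedType.Exports.
Local Open Scope classical_set_scope.
Local Open Scope ring_scope.

(** The graph [G] of a closed semiregular operator [T] is a norm-closed right
    [A]-submodule of the direct sum of two copies of [A].  Over a
    C*-algebra [A] of compact operators every such submodule is orthogonally
    complemented ([closed_submodule_complemented]).  So for [a] in [A] one can
    write [(a, 0) = (x, T x) + r] with [r] orthogonal to the graph, which says
    that [T x] is in the domain of [T^*] and [T^* (T x) = a - x]: the range of
    [1 + T^* T] is all of [A].

    To complement [G], regard pairs [b] of elements of [A] as operators from [H]
    to the Hilbert sum [H + H], and let [P] be the orthogonal projection onto
    the closed span of the ranges of the elements of [G].  The residual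
    [b - P b] is orthogonal to [G], so everything is in showing that [P b] is in
    [G].  As [G] is closed, it is enough to approximate [P b] in norm by
    elements of [G].  For a contraction [h] in [G], the operator
    [S = 1 - h h^*] is a contraction, fixes the range of [1 - P], and [b - S b]
    is in [G], because it is [h (h^* b)] with [h^* b] in [A], and [G] is a right
    module.
    These properties pass to products of such operators ([shrinking]).  The
    powers of [S] tend to 0 on the range of [h] ([defect_range_small]); by
    composing such powers one makes any finite set of vectors in the range of
    [P] small ([span_small], [small_finite]).  As [b] is compact, the image of
    the unit ball under [P b] has a finite net, and as the operators [S] are
    contractions, one [S] makes [S P b] small in norm ([G_proj_approx]).  Then
    [b - S b = P b - S P b] is an element of [G] close to [P b].

    The Hilbert space theory (Riesz representation, projections, adjoints) is
    done for the real part of the inner product, which avoids complex-valued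
    estimates and treats [H] and [H + H] alike. *)

Set Implicit Arguments.
Unset Strict Implicit.
Unset Printing Implicit Defensive.

(** * Complete real inner products *)

Section Definitions.
Local Open Scope complex_scope.

(** A complete real inner product on a complex vector space: the real part of
    a Hilbert space inner product.  Multiplication by a complex scalar has
    multiplication by its conjugate as adjoint.  Completeness is that of
    sequences, for the squared norm [B x x], so that no topology on [V] is
    involved. *)
Record hilbert_form (R : realType) (V : lmodType R[i]) (B : V -> V -> R)
    : Prop := HilbertForm {
  hfC : forall x y, B x y = B y x ;
  hfDl : forall x y z, B (x + y) z = B x z + B y z ;
  hfZl : forall (t : R) x y, B (t%:C *: x) y = t * B x y ;
  hf_conj : forall (c : R[i]) x y, B (c *: x) y = B x (Num.conj c *: y) ;
  hf_ge0 : forall x, 0 <= B x x ;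
  hf_eq0 : forall x, B x x = 0 -> x = 0 ;
  hf_complete : forall u : nat -> V,
    (forall e, 0 < e -> exists N, forall m n, (N <= m)%N -> (N <= n)%N ->
      B (u m - u n) (u m - u n) <= e) ->
    exists l, forall e, 0 < e -> exists N, forall n, (N <= n)%N ->
      B (u n - l) (u n - l) <= e }.

(** Closedness of a set for the norm that the form [B] defines. *)
Definition hclosed (R : realType) (V : lmodType R[i]) (B : V -> V -> R)
    (K : set V) :=
  forall v, (forall e, 0 < e -> exists2 k, K k & B (v - k) (v - k) <= e) -> K v.

End Definitions.

(** Linear subspaces, as sets. *)
Definition linear_subspace (F : pzRingType) (V : lmodType F) (K : set V) :=
  K 0 /\ forall (c : F) x y, K x -> K y -> K (c *: x + y).

Section LinearSubspace.
Context (F : pzRingType) (V : lmodType F) (K : set V).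
Hypothesis K_sub : linear_subspace K.

Lemma linear_subspaceD x y : K x -> K y -> K (x + y).
Proof. by move=> Kx Ky; rewrite -[x]scale1r; apply: K_sub.2. Qed.

Lemma linear_subspaceZ c x : K x -> K (c *: x).
Proof.
by move=> Kx; rewrite -[c *: x]addr0; apply: K_sub.2 => //; exact: K_sub.1.
Qed.

Lemma linear_subspaceB x y : K x -> K y -> K (x - y).
Proof. by move=> Kx Ky; rewrite addrC -scaleN1r; apply: K_sub.2. Qed.

End LinearSubspace.

Lemma submod_closed_subspace (F : pzRingType) (V : lmodType F) (K : set V) :
  submod_closed (mem K) -> linear_subspace K.
Proof.
move=> [K0 KZ]; split=> [|c x y Kx Ky]; first by rewrite inE in K0.
by have := KZ c x y (mem_set Kx) (mem_set Ky); rewrite inE.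
Qed.

Lemma linear_map0 (F : pzRingType) (V W : lmodType F) (f : V -> W) :
  linear f -> f 0 = 0.
Proof.
by move=> lf; have := lf (-1) 0 0; rewrite scaler0 addr0 scaleN1r addNr.
Qed.

Lemma linear_mapB (F : pzRingType) (V W : lmodType F) (f : V -> W) x y :
  linear f -> f (x - y) = f x - f y.
Proof. by move=> lf; rewrite addrC -scaleN1r lf scaleN1r addrC. Qed.

Section HilbertForm.
Local Open Scope complex_scope.
Context (R : realType) (V : lmodType R[i]) (B : V -> V -> R).
Hypothesis hB : hilbert_form B.

Lemma hfDr x y z : B x (y + z) = B x y + B x z.
Proof. by rewrite !(hfC hB x) (hfDl hB). Qed.

Lemma hfZr t x y : B x (t%:C *: y) = t * B x y.
Proof. by rewrite !(hfC hB x) (hfZl hB). Qed.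

Lemma hfNl x y : B (- x) y = - B x y.
Proof.
by have := hfZl hB (-1) x y; rewrite rmorphN rmorph1 scaleN1r mulN1r.
Qed.

Lemma hfNr x y : B x (- y) = - B x y.
Proof. by rewrite hfC // hfNl hfC. Qed.

Lemma hf0l y : B 0 y = 0.
Proof. by have := hfZl hB 0 0 y; rewrite scaler0 mul0r. Qed.

Lemma hf0r x : B x 0 = 0.
Proof. by rewrite hfC // hf0l. Qed.

Definition hfE := (hfDr, hfDl hB, hfZl hB, hfZr, hfNl, hfNr, hf0l, hf0r).

Lemma hf_normZ (c : R[i]) x :
  B (c *: x) (c *: x) = (complex.Re `|c|) ^+ 2 * B x x.
Proof.
rewrite (hf_conj hB) scalerA -hfZr; congr (B x (_ *: x)).
rewrite mulrC -normCK [in LHS](_ : `|c| = (complex.Re `|c|)%:C).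
  by rewrite -rmorphXn.
by rewrite RRe_real // normr_real.
Qed.

Lemma hf_cauchy_schwarz x y : B x y ^+ 2 <= B x x * B y y.
Proof.
have [y0|y0] := eqVneq (B y y) 0.
  by rewrite (hf_eq0 hB y0) !hfE expr0n mulr0.
have yp : 0 < B y y by rewrite lt_def y0 hf_ge0.
have := hf_ge0 hB ((B y y)%:C *: x - (B x y)%:C *: y).
rewrite !hfE (hfC hB y x) => h.
have : 0 <= B y y * (B x x * B y y - B x y ^+ 2) by lra.
by rewrite pmulr_rge0 // subr_ge0.
Qed.

Lemma hf_sqrD x y : B (x + y) (x + y) <= 2 * B x x + 2 * B y y.
Proof.
by have := hf_ge0 hB (x - y); rewrite !hfE (hfC hB y x) => h; lra.
Qed.

(** Riesz representation on a closed subspace [K]: the minimiser over [K] of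
    [J x = B x x - 2 * f x] represents [f].  The bound [C] says that [J] is
    bounded below; for a bounded functional, the square of its norm will do. *)
Theorem riesz_subspace (K : set V) (f : V -> R) (C : R) :
  linear_subspace K -> hclosed B K ->
  (forall x y, f (x + y) = f x + f y) ->
  (forall (t : R) x, f (t%:C *: x) = t * f x) ->
  (forall x, 2 * f x <= B x x + C) ->
  exists2 p, K p & forall x, K x -> B p x = f x.
Proof.
move=> [K0 KD] Kc fD fZ fC.
pose J x := B x x - 2 * f x.
have hi : has_inf [set J x | x in K].
  split; first by exists (J 0), 0.
  by exists (- C) => _ [x _ <-]; rewrite /J; have := fC x; lra.
set m := inf [set J x | x in K].
have mJ x : K x -> m <= J x.
  by move=> Kx; apply: ge_inf; [exact: hi.2 | exists x].
have minP e : 0 < e -> exists2 x, K x & J x < m + e.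
  by move=> e0; have [_ [x Kx <-] ?] := inf_adherent e0 hi; exists x.
have /choice[u uP] : forall n : nat, exists x, K x /\ J x < m + n.+1%:R^-1.
  by move=> n; have [|x Kx Jx] := minP n.+1%:R^-1; [rewrite invr_gt0|exists x].
(* parallelogram identity, with the midpoint of x and y as competitor *)
have dist x y : K x -> K y ->
    B (x - y) (x - y) <= 2 * (J x - m) + 2 * (J y - m).
  move=> Kx Ky; have := mJ (2^-1%:C *: (x + y)).
  rewrite /J fZ fD !hfE (hfC hB y x) => h.
  have /h : K (2^-1%:C *: (x + y)).
    rewrite -[_ *: _]addr0; apply: (KD) => //.
    by rewrite -[x]scale1r; exact: KD.
  by lra.
have cu e : 0 < e -> exists N, forall n, (N <= n)%N -> n.+1%:R^-1 <= e :> R.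
  move=> e0; exists (Num.truncn e^-1) => n Nn.
  rewrite invf_ple ?posrE//; apply: ltW; apply: lt_le_trans (truncnS_gt _) _.
  by rewrite ler_nat.
have [|p pP] := hf_complete hB (u := u).
  move=> e e0; have [|N NP] := cu (e / 4); first by rewrite divr_gt0.
  exists N => a b /NP ha /NP hb.
  have [Ka Ja] := uP a; have [Kb Jb] := uP b.
  have {Ja ha} Ja := lt_le_trans Ja (lerD (lexx m) ha).
  have {Jb hb} Jb := lt_le_trans Jb (lerD (lexx m) hb).
  by have := dist _ _ Ka Kb; lra.
have pP' e : 0 < e ->
    exists n, B (u n - p) (u n - p) <= e /\ n.+1%:R^-1 <= e :> R.
  move=> e0; have [N NP] := pP _ e0; have [N' NP'] := cu _ e0.
  by exists (maxn N N'); split; [apply: NP|apply: NP'];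
    rewrite ?leq_maxl ?leq_maxr.
exists p.
  apply: Kc => e e0; have [n [nP _]] := pP' _ e0.
  exists (u n); first by case: (uP n).
  by rewrite -opprB !hfE; move: nP; rewrite !hfE; lra.
(* the representation defect is squeezed to 0 by comparing J at u n and at
   u n + s x, with s close to the minimiser of this quadratic in s; taking
   q + 1 instead of q for the denominator avoids the case q = 0 *)
move=> x Kx; apply/eqP; rewrite -subr_eq0 -sqrf_eq0 eq_le sqr_ge0 andbT.
apply/ler_addgt0Pr => e e0; rewrite add0r.
have q0 := hf_ge0 hB x; set q := B x x in q0.
pose d := e / (4 * (q + 1)).
have d0 : 0 < d by rewrite divr_gt0 // mulr_gt0 // ltr_wpDl.
have [n [n1 n2]] := pP' _ d0; have [Kn Jn] := uP n.
have eE : e = 4 * (q + 1) * d.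
  by rewrite /d mulrCA divff ?mulr1 // mulf_neq0 // gt_eqF // ltr_wpDl.
have Jnx t : m <= J (t%:C *: x + u n) by apply: mJ; apply: KD.
pose g := B (u n) x - f x.
have g2 : g ^+ 2 <= d * (q + 1).
  have := Jnx (- g / (q + 1)); rewrite /J fD fZ !hfE (hfC hB x (u n)) -/q => h.
  set s := - g / (q + 1) in h.
  have gE : g = - s * (q + 1).
    by rewrite /s mulNr divfK ?opprK // gt_eqF // ltr_wpDl.
  have {}Jn := lt_le_trans Jn (lerD (lexx m) n2).
  have h1 : 0 <= s * (s * q) + 2 * s * g + d.
    by rewrite /g; rewrite /J in Jn; lra.
  have s2 : 0 <= s ^+ 2 by exact: sqr_ge0.
  have h2 : s ^+ 2 * (q + 1) <= d.
    by move: h1 s2; rewrite gE; move=> *; lra.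
  rewrite gE exprMn sqrrN expr2 [(q + 1) ^+ 2]expr2 mulrA.
  apply: ler_wpM2r; first lra.
  by move: h2; rewrite expr2.
have r2 : B (u n - p) x ^+ 2 <= d * q.
  by apply: (le_trans (hf_cauchy_schwarz _ _)); rewrite ler_wpM2r.
have -> : B p x - f x = g - B (u n - p) x by rewrite /g !hfE; ring.
set r := B (u n - p) x in r2 *.
have h3 : (g - r) ^+ 2 <= 2 * g ^+ 2 + 2 * r ^+ 2.
  by have := sqr_ge0 (g + r); lra.
by rewrite eE; nra.
Qed.

Theorem projection_subspace (K : set V) v :
  linear_subspace K -> hclosed B K ->
  exists2 p, K p & forall x, K x -> B (v - p) x = 0.
Proof.
move=> Ks Kc.
have [||x|p Kp pP] := @riesz_subspace K (B v) (B v v) Ks Kc.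
- by move=> x y; rewrite hfDr.
- by move=> t x; rewrite hfZr.
- by have := hf_ge0 hB (x - v); rewrite !hfE (hfC hB v x); lra.
by exists p => // x Kx; rewrite !hfE pP // subrr.
Qed.

End HilbertForm.

Section DirectSum.
Local Open Scope complex_scope.

(** The form of the Hilbert direct sum. *)
Definition prod_form (R : realType) (V W : lmodType R[i]) (B : V -> V -> R)
  (C : W -> W -> R) (p q : V * W) : R := B p.1 q.1 + C p.2 q.2.

Lemma prod_form_hilbert (R : realType) (V W : lmodType R[i])
    (B : V -> V -> R) (C : W -> W -> R) :
  hilbert_form B -> hilbert_form C -> hilbert_form (prod_form B C).
Proof.
move=> hB hC; rewrite /prod_form; split.
- by move=> x y; rewrite (hfC hB) (hfC hC).
- by move=> x y z /=; rewrite (hfDl hB) (hfDl hC) addrACA.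
- by move=> t x y /=; rewrite (hfZl hB) (hfZl hC) mulrDr.
- by move=> c x y /=; rewrite (hf_conj hB) (hf_conj hC).
- by move=> x; rewrite addr_ge0 ?(hf_ge0 hB) ?(hf_ge0 hC).
- move=> [x y] /= /eqP; rewrite paddr_eq0 ?(hf_ge0 hB) ?(hf_ge0 hC) //.
  by move=> /andP[/eqP/(hf_eq0 hB)-> /eqP/(hf_eq0 hC)->].
move=> u cu.
have [|l lP] := hf_complete hB (u := fun n => (u n).1).
  move=> e /cu[N NP]; exists N => m n Nm Nn; apply: le_trans (NP m n Nm Nn).
  by rewrite lerDl (hf_ge0 hC).
have [|k kP] := hf_complete hC (u := fun n => (u n).2).
  move=> e /cu[N NP]; exists N => m n Nm Nn; apply: le_trans (NP m n Nm Nn).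
  by rewrite lerDr (hf_ge0 hB).
exists (l, k) => e e0.
have e20 : 0 < e / 2 by rewrite divr_gt0.
have [N NP] := lP _ e20; have [M MP] := kP _ e20.
exists (maxn N M) => n; rewrite geq_max => /andP[/NP h1 /MP h2] /=.
by move: h1 h2; lra.
Qed.

End DirectSum.

(** * Adjoints of bounded operators *)

Section Adjoint.
Local Open Scope complex_scope.
Context (R : realType) (H : completeNormedModType R[i]).
Variable ip : {dot H for @Num.conj R[i]}.
Hypothesis ip_norm : forall x : H, `|x| ^+ 2 = ip x x.

(** The real part of the inner product; its values on the diagonal are the
    squared norms. *)
Definition rip (x y : H) : R := complex.Re (ip x y).

Lemma ReM_real (t : R) (z : R[i]) : complex.Re (t%:C * z) = t * complex.Re z.
Proof. by case: z => a b /=; rewrite mul0r subr0. Qed.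

Lemma norm_ReE (x : H) : `|x| = (complex.Re `|x|)%:C.
Proof. by rewrite RRe_real // normr_real. Qed.

Lemma ripE (x : H) : rip x x = (complex.Re `|x|) ^+ 2.
Proof.
rewrite /rip -ip_norm -[in LHS](RRe_real (normr_real x)).
by rewrite -rmorphXn /=.
Qed.

Lemma Re_norm_ge0 (x : H) : 0 <= complex.Re `|x|.
Proof. by rewrite -lecR -norm_ReE; exact: normr_ge0. Qed.

Lemma norm_rip (x : H) (r : R) : 0 <= r -> (`|x| <= r%:C) = (rip x x <= r ^+ 2).
Proof.
by move=> r0; rewrite norm_ReE lecR ripE ler_pXn2r // nnegrE // Re_norm_ge0.
Qed.

Lemma rip_hilbert : hilbert_form rip.
Proof.
have ipC x y : ip x y = Num.conj (ip y x) by rewrite hermC expr0 mul1r.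
split.
- move=> x y; rewrite /rip ipC; by case: (ip y x).
- by move=> x y z; rewrite /rip linearDl raddfD.
- by move=> t x y; rewrite /rip linearZl_LR /= ReM_real.
- by move=> c x y; rewrite /rip linearZl_LR linearZr_LR /= conjCK.
- by move=> x; rewrite ripE sqr_ge0.
- move=> x /eqP; rewrite ripE sqrf_eq0 => /eqP h; apply/eqP.
  by rewrite -normr_eq0 norm_ReE h.
move=> u cu.
have uc : cauchy (u @ \oo).
  apply: cauchy_exP => eps eps0.
  have epsE : eps = (complex.Re eps)%:C by rewrite RRe_real // gtr0_real.
  have e0 : 0 < complex.Re eps by rewrite -ltcR -epsE.
  have e20 : 0 < complex.Re eps / 2 by rewrite divr_gt0.
  have [|N NP] := cu ((complex.Re eps / 2) ^+ 2); first by rewrite exprn_gt0.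
  exists (u N); exists N => // n Nn /=.
  rewrite -ball_normE /=; apply: (@le_lt_trans _ _ (complex.Re eps / 2)%:C).
    by rewrite norm_rip; [apply: NP | exact: ltW].
  by rewrite [ltRHS]epsE ltcR; lra.
have /cauchy_cvgP/cvgrPdist_le ul := uc.
exists (lim (u @ \oo)) => e e0.
have s0 : 0 < Num.sqrt e by rewrite sqrtr_gt0.
have [|N _ NP] := ul (Num.sqrt e)%:C; first by rewrite ltcR.
exists N => n Nn; have := NP n Nn.
by rewrite -normrN opprB norm_rip ?sqr_sqrtr // ltW.
Qed.
Let hB := rip_hilbert.

Lemma rip_ext (x y : H) : (forall z, rip z x = rip z y) -> x = y.
Proof.
move=> h; apply/eqP; rewrite -subr_eq0; apply/eqP/(hf_eq0 hB).
by rewrite (hfDr hB) (hfNr hB) h subrr.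
Qed.

(** An adjunction identity between the real parts of the inner products is one
    between the inner products: replace [x] by [i x]. *)
Lemma rip_ip (f : H -> H) (y w : H) : linear f ->
  (forall x, rip (f x) y = rip x w) -> forall x, ip (f x) y = ip x w.
Proof.
move=> lf h x; have := h x; have := h ('i *: x).
have -> : f ('i *: x) = 'i *: f x.
  by have := lf 'i x 0; rewrite (linear_map0 lf) !addr0.
rewrite /rip !linearZl_LR /=.
case: (ip (f x) y) => a b; case: (ip x w) => c d /=.
by rewrite !mul0r !mul1r !sub0r => /oppr_inj -> ->.
Qed.

Lemma bop_rip_bounded (f : bop H) :
  exists2 M : R, 0 < M & forall x, rip (f x) (f x) <= M * rip x x.
Proof.
have [M M0 fM] := bop_bounded f.
have ME : M = (complex.Re M)%:C by rewrite RRe_real // ger0_real.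
exists (complex.Re M ^+ 2 + 1) => [|x].
  by rewrite ltr_wpDl ?ltr01 ?sqr_ge0.
have x2 := hf_ge0 hB x.
apply: (@le_trans _ _ (complex.Re M ^+ 2 * rip x x)); last first.
  by rewrite ler_wpM2r // lerDl.
have := fM x; rewrite ME (norm_ReE x) -rmorphM norm_rip.
  by rewrite exprMn -ripE.
by rewrite mulr_ge0 ?Re_norm_ge0 // -lecR -ME.
Qed.

Lemma bounded_linear_rip (f : H -> H) (M : R) : linear f ->
  (forall x, rip (f x) (f x) <= M * rip x x) -> f \in @bounded_linear R H.
Proof.
move=> lf fM; rewrite inE; split=> //; exists (Num.sqrt `|M|)%:C => x.
rewrite (norm_ReE x) -rmorphM norm_rip; last first.
  by rewrite mulr_ge0 ?Re_norm_ge0 ?sqrtr_ge0.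
rewrite exprMn sqr_sqrtr // -ripE (le_trans (fM x)) //.
by rewrite ler_wpM2r ?(hf_ge0 hB) // ler_norm.
Qed.

(** Riesz representation of [x |-> rip (f x) y], for each [y]. *)
Lemma bop_adj_exists (f : bop H) :
  exists g : bop H, forall x y, ip (f x) y = ip x (g y).
Proof.
have [M M0 fM] := bop_rip_bounded f.
have M0' : M != 0 by rewrite gt_eqF.
have /choice[g gP] : forall y, exists w, forall x, rip (f x) y = rip x w.
  move=> y.
  have [|||||w _ wP] := @riesz_subspace _ _ _ hB setT
    (fun x => rip (f x) y) (M * rip y y).
  - by split.
  - by move=> v _.
  - by move=> x x'; rewrite linearD (hfDl hB).
  - by move=> t x; rewrite linearZ /= (hfZl hB).
  - move=> x; have h := hf_ge0 hB (M^-1%:C *: f x - y).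
    have : 0 <= M * rip (M^-1%:C *: f x - y) (M^-1%:C *: f x - y).
      by rewrite mulr_ge0 // ltW.
    rewrite !(hfE hB) (hfC hB y (f x)).
    rewrite [X in 0 <= X](_ : _ =
      M^-1 * rip (f x) (f x) - 2 * rip (f x) y + M * rip y y); last by field.
    have := fM x; rewrite mulrC -ler_pdivrMr // mulrC => h1 h2; lra.
  by exists w => x; rewrite -wP // (hfC hB).
have lg : linear g.
  move=> c y y'; apply: rip_ext => x; rewrite -gP !(hfDr hB) !gP; congr (_ + _).
  have Z a b : rip a (c *: b) = rip (Num.conj c *: a) b.
    by rewrite (hf_conj hB) conjCK.
  by rewrite Z -!gP Z linearZ.
have bg : g \in @bounded_linear R H.
  apply: (@bounded_linear_rip g M) => // y.
  have h1 : rip (g y) (g y) ^+ 2 <= M * rip y y * rip (g y) (g y).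
    rewrite -[X in X ^+ 2]gP; apply: (le_trans (hf_cauchy_schwarz hB _ _)).
    by rewrite mulrAC ler_wpM2r ?(hf_ge0 hB).
  have [g0|g0] := eqVneq (rip (g y) (g y)) 0.
    by rewrite g0 mulr_ge0 ?(hf_ge0 hB) // ltW.
  by move: h1; rewrite expr2 ler_pM2r // lt_def g0 (hf_ge0 hB).
exists (Bop bg) => x y /=; apply: (@rip_ip f y (g y)) => //.
exact: bop_linear.
Qed.

(** The operator [bop_adj ip f] is the adjoint of [f], not the default value of
    its definition. *)
Lemma bop_adjP (f : bop H) x y : ip (f x) y = ip x (bop_adj ip f y).
Proof.
by rewrite /bop_adj; case: xgetP => [g _ ->//|h]; have [g /h] := bop_adj_exists f.
Qed.

Lemma bop_adjE (f : bop H) x y : rip (f x) y = rip x (bop_adj ip f y).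
Proof. by rewrite /rip bop_adjP. Qed.

Lemma bop_adj_swap (f : bop H) x y : rip (bop_adj ip f x) y = rip x (f y).
Proof. by rewrite (hfC hB) -bop_adjE (hfC hB). Qed.

Lemma bop_ext (f g : bop H) : (forall x y, rip x (f y) = rip x (g y)) -> f = g.
Proof. by move=> h; apply: bopP => y; apply: rip_ext => x. Qed.

Lemma bop_adjB (f g : bop H) : bop_adj ip (f - g) = bop_adj ip f - bop_adj ip g.
Proof.
apply: bop_ext => x y /=.
rewrite -bop_adjE [RHS](hfDr hB) (hfNr hB) -!bop_adjE.
by rewrite -(hfNl hB) -(hfDl hB).
Qed.

Lemma bop_adj0 : bop_adj ip 0 = 0.
Proof. by have := bop_adjB 0 0; rewrite !subrr. Qed.

Lemma bop_adjM (f g : bop H) : bop_adj ip (f * g) = bop_adj ip g * bop_adj ip f.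
Proof.
apply: bop_ext => x y /=.
by rewrite -bop_adjE /= -!bop_adjE.
Qed.

Lemma bop_adjK (f : bop H) : bop_adj ip (bop_adj ip f) = f.
Proof. by apply: bop_ext => x y; rewrite -bop_adjE bop_adj_swap. Qed.

Lemma bop_adjMself_eq0 (f : bop H) : bop_adj ip f * f = 0 -> f = 0.
Proof.
move=> f0; apply: bopP => x; apply: (hf_eq0 hB).
by rewrite bop_adjE -[bop_adj ip f (f x)]/((bop_adj ip f * f) x) f0 (hf0r hB).
Qed.

End Adjoint.

(** * Closed submodules over an algebra of compact operators *)

Section Complement.
Local Open Scope complex_scope.
Context (R : realType) (H : completeNormedModType R[i]).
Variable ip : {dot H for @Num.conj R[i]}.
Hypothesis ip_norm : forall x : H, `|x| ^+ 2 = ip x x.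
Variable A : set (bop H).
Hypothesis A_cstar : cstar_subalgebra ip A.
Variable G : set (bop H * bop H).
Hypothesis G_sub : linear_subspace G.
Hypothesis GA : forall h, G h -> A h.1 /\ A h.2.
Hypothesis G_mod : forall h a, G h -> A a -> G (h.1 * a, h.2 * a).
Hypothesis G_closed : closed G.

Let hB := rip_hilbert ip_norm.
Let B2 := prod_form (rip ip) (rip ip).
Let hB2 : hilbert_form B2 := prod_form_hilbert hB hB.

(** A pair of operators acts from [H] to the direct sum of two copies of [H];
    [pair_adj] is the adjoint of this action. *)
Definition pair_app (h : bop H * bop H) (x : H) : H * H := (h.1 x, h.2 x).
Definition pair_adj (h : bop H * bop H) (z : H * H) : H :=
  bop_adj ip h.1 z.1 + bop_adj ip h.2 z.2.

Lemma pair_adjE h x z : B2 (pair_app h x) z = rip ip x (pair_adj h z).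
Proof. by rewrite /B2 /prod_form /= !(bop_adjE ip_norm) -(hfDr hB). Qed.

Lemma pair_appB g h x : pair_app (g - h) x = pair_app g x - pair_app h x.
Proof. by []. Qed.

Lemma pair_app_linear h : linear (pair_app h).
Proof. by move=> c x y; rewrite /pair_app !linearP. Qed.

Lemma pair_adj_linear h : linear (pair_adj h).
Proof.
by move=> c x y; rewrite /pair_adj /= !linearP scalerDr addrACA.
Qed.

Let A_sub : linear_subspace A := submod_closed_subspace (cstar_linear A_cstar).

(** The orthogonal complement of the vectors [g x] with [g] in [G]. *)
Definition G_perp (z : H * H) := forall h x, G h -> B2 (pair_app h x) z = 0.

(** Linear contractions that fix the orthogonal complement of [G] and move every
    pair of elements of [A], as an operator, by an element of [G].  They stand
    for the operators [1 - u], with [u] in an approximate unit of the algebra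
    spanned by the products [g h^*] with [g], [h] in [G]. *)
Record shrinking (S : H * H -> H * H) : Prop := Shrinking {
  sh_linear : linear S ;
  sh_le : forall z, B2 (S z) (S z) <= B2 z z ;
  sh_perp : forall z, G_perp z -> S z = z ;
  sh_mod : forall b, A b.1 -> A b.2 ->
    exists2 g, G g & forall x, S (pair_app b x) = pair_app b x - pair_app g x }.

Lemma shrinking_id : shrinking id.
Proof.
split=> // b _ _; exists 0; first exact: G_sub.1.
by move=> x; rewrite -pair_appB subr0.
Qed.

Lemma shrinking_comp S S' : shrinking S -> shrinking S' -> shrinking (S \o S').
Proof.
move=> [Sl Sc Sp Sm] [Sl' Sc' Sp' Sm']; split=> /=.
- by move=> c x y; rewrite /= Sl' Sl.
- by move=> z; apply: le_trans (Sc' z).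
- by move=> z zP; rewrite Sp' // Sp.
move=> b b1 b2; have [g Gg gP] := Sm' b b1 b2.
have [g1 g2] := GA Gg.
have [|| g' Gg' gP'] := Sm (b - g); [exact: linear_subspaceB..|].
exists (g + g') => [|x]; first exact: linear_subspaceD.
rewrite gP -pair_appB gP' -!pair_appB; congr (pair_app _ x).
by rewrite opprD addrA.
Qed.

(** The operator [1 - h h^*]. *)
Definition defect (h : bop H * bop H) (z : H * H) :=
  z - pair_app h (pair_adj h z).

Section Defect.
Variable h : bop H * bop H.
Hypothesis Gh : G h.
Hypothesis h1 : forall x, B2 (pair_app h x) (pair_app h x) <= rip ip x x.

Lemma defect_adj x y : B2 (defect h x) y = B2 x (defect h y).
Proof.
rewrite /defect (hfDl hB2) (hfNl hB2) pair_adjE (hfDr hB2) (hfNr hB2).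
by rewrite (hfC hB2 x (pair_app _ _)) pair_adjE (hfC hB).
Qed.

Lemma defect_drop z :
  B2 (defect h z) (defect h z) + rip ip (pair_adj h z) (pair_adj h z) <= B2 z z.
Proof.
have := h1 (pair_adj h z).
rewrite /defect !(hfDl hB2, hfDr hB2, hfNl hB2, hfNr hB2).
rewrite (hfC hB2 z (pair_app _ _)) (pair_adjE h _ z) => h2; lra.
Qed.

Lemma shrinking_defect : shrinking (defect h).
Proof.
split.
- move=> c x y; rewrite /defect pair_adj_linear pair_app_linear opprD addrACA.
  by rewrite scalerBr.
- move=> z; apply: le_trans (defect_drop z).
  by rewrite lerDl (hf_ge0 hB).
- move=> z zP; rewrite /defect.
  have -> : pair_adj h z = 0 by apply: (hf_eq0 hB); rewrite -pair_adjE zP.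
  by rewrite (linear_map0 (pair_app_linear h)) subr0.
move=> b b1 b2.
have [Ah1 Ah2] := GA Gh.
set a := bop_adj ip h.1 * b.1 + bop_adj ip h.2 * b.2.
exists (h.1 * a, h.2 * a) => //.
apply: G_mod => //; apply: (linear_subspaceD A_sub);
  by apply: (cstar_mul A_cstar) => //; exact: (cstar_adj A_cstar).
Qed.

Lemma iter_defect_adj m x y :
  B2 (iter m (defect h) x) (iter m (defect h) y) =
  B2 x (iter (m + m) (defect h) y).
Proof.
elim: m x y => // m IH x y.
by rewrite (iterSr m _ x) (iterSr m _ y) IH defect_adj addSn addnS iterS iterSr.
Qed.

Lemma shrinking_iter m : shrinking (iter m (defect h)).
Proof.
elim: m => [|m IH]; first exact: shrinking_id.
exact: (shrinking_comp shrinking_defect IH).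
Qed.

(** The powers of [S = 1 - h h^*] tend to 0 on the range of [h].  With
    [w m = S ^ m (h x)], the squared norms of the [w m] decrease by at least
    that of [h^* (w m)] at each step, so some [h^* (w (2 m))] is small, and the
    squared norm of [w m] is the inner product of [x] and [h^* (w (2 m))]. *)
Lemma defect_range_small x e : 0 < e ->
  exists2 S, shrinking S & B2 (S (pair_app h x)) (S (pair_app h x)) <= e.
Proof.
move=> e0; pose w m := iter m (defect h) (pair_app h x).
pose D := [set B2 (w m) (w m) | m in setT].
have hi : has_inf D.
  split; first by exists (B2 (w 0) (w 0)), 0%N.
  by exists 0 => _ [m _ <-]; exact: hf_ge0.
have q0 := hf_ge0 hB x; set q := rip ip x x in q0.
have d0 : 0 < e ^+ 2 / (q + 1) by rewrite divr_gt0 ?exprn_gt0 // ltr_wpDl.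
set d := e ^+ 2 / (q + 1) in d0.
have [_ [m _ <-] mP] := inf_adherent d0 hi.
exists (iter m (defect h)); first exact: shrinking_iter.
have wle : B2 (w (m + m)%N) (w (m + m)%N) <= B2 (w m) (w m).
  by rewrite {1 2}/w iterD; exact: (sh_le (shrinking_iter m)).
have lew : inf D <= B2 (w (m + m).+1) (w (m + m).+1).
  by apply: ge_inf; [exact: hi.2|exists (m + m).+1].
have := defect_drop (w (m + m)%N); rewrite -[defect h _]/(w (m + m).+1) => dr.
(* the squared norm at 2m exceeds the infimum by less than d, the one at
   2m + 1 is at least the infimum *)
have small :
    rip ip (pair_adj h (w (m + m)%N)) (pair_adj h (w (m + m)%N)) <= d by lra.
have := hf_cauchy_schwarz hB x (pair_adj h (w (m + m)%N)).
rewrite -pair_adjE -iter_defect_adj -/(w m) -/q => h2.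
rewrite -(ler_pXn2r (n := 2)) // ?nnegrE ?(hf_ge0 hB2) ?(ltW e0) //.
apply: (le_trans h2); apply: (@le_trans _ _ (q * d)); first exact: ler_wpM2l.
by rewrite /d mulrCA ler_piMr ?sqr_ge0 // ler_pdivrMr ?ltr_wpDl // mul1r lerDl.
Qed.

End Defect.

Lemma range_small h x e : G h -> 0 < e ->
  exists2 S, shrinking S & B2 (S (pair_app h x)) (S (pair_app h x)) <= e.
Proof.
move=> Gh e0.
have [M1 M10 M1P] := bop_rip_bounded ip_norm h.1.
have [M2 M20 M2P] := bop_rip_bounded ip_norm h.2.
(* rescale h to a contraction, and x by the inverse factor *)
have s0 : 0 < Num.sqrt (M1 + M2) by rewrite sqrtr_gt0 addr_gt0.
set s := Num.sqrt (M1 + M2) in s0.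
have appZ y : pair_app (s^-1%:C *: h) y = s^-1%:C *: pair_app h y by [].
have [||S Ss SP] := @defect_range_small (s^-1%:C *: h) _ _ (s%:C *: x) e e0.
- exact: (linear_subspaceZ G_sub).
- move=> y; rewrite appZ !(hfZl hB2) !(hfZr hB2) mulrA -expr2 exprVn.
  rewrite sqr_sqrtr ?addr_ge0 ?(ltW M10) ?(ltW M20) // ler_pdivrMl ?addr_gt0 //.
  by rewrite mulrDl; apply: lerD; [exact: M1P|exact: M2P].
exists S => //; move: SP; rewrite appZ -[s%:C *: x]addr0 pair_app_linear.
have -> : pair_app h 0 = 0 by rewrite /pair_app !linear0.
by rewrite addr0 scalerA -rmorphM mulVf ?gt_eqF // scale1r.
Qed.

(** The smallest closed subspace that contains all [g x] with [g] in [G]. *)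
Definition G_span (v : H * H) := forall K, linear_subspace K -> hclosed B2 K ->
  (forall h x, G h -> K (pair_app h x)) -> K v.

Lemma G_span_subspace : linear_subspace G_span.
Proof.
split=> [K [] //|c x y xP yP K Ks Kc KG].
by apply: (Ks.2); [exact: xP|exact: yP].
Qed.

Lemma G_span_hclosed : hclosed B2 G_span.
Proof.
move=> v vP K Ks Kc KG; apply: (Kc) => e /vP[k kP ke]; exists k => //; exact: kP.
Qed.

Lemma G_span_app h x : G h -> G_span (pair_app h x).
Proof. by move=> Gh K _ _; apply. Qed.

(** The vectors [v] with this property for all [S0] form a closed subspace [K].
    Quantifying over [S0] makes [K] stable under sums, and costs nothing on the
    generators, since [S0] maps [h x] to [h' x] with [h'] in [G]. *)
Lemma span_small v S0 e : G_span v -> shrinking S0 -> 0 < e ->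
  exists2 S, shrinking S & B2 (S (S0 v)) (S (S0 v)) <= e.
Proof.
move=> vP; pose K v := forall S0 e, shrinking S0 -> 0 < e ->
  exists2 S, shrinking S & B2 (S (S0 v)) (S (S0 v)) <= e.
suff /(_ S0 e) : K v by [].
apply: vP; first split.
- move=> T d sT d0; exists id; first exact: shrinking_id.
  by rewrite (linear_map0 (sh_linear sT)) (hf0l hB2) ltW.
- move=> c x y Kx Ky T e' sT e0'.
  set r := complex.Re `|c|.
  have r0 : 0 <= r ^+ 2 by exact: sqr_ge0.
  have [||S1 sS1 S1P] := Kx T (e' / (4 * (r ^+ 2 + 1))) => //.
    by rewrite divr_gt0 // mulr_gt0 // ltr_wpDl.
  have [||S2 sS2 S2P] := Ky (S1 \o T) (e' / 4).
  - exact: shrinking_comp.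
  - by rewrite divr_gt0.
  exists (S2 \o S1); first exact: shrinking_comp.
  rewrite /= (sh_linear sT) (sh_linear sS1) (sh_linear sS2).
  apply: (le_trans (hf_sqrD hB2 _ _)); rewrite (hf_normZ hB2) -/r.
  have h3 := le_trans (sh_le sS2 _) S1P.
  have h4 : r ^+ 2 * B2 (S2 (S1 (T x))) (S2 (S1 (T x))) <= e' / 4.
    apply: (le_trans (ler_wpM2l r0 h3)).
    have r1 : 0 < r ^+ 2 + 1 by rewrite ltr_wpDl.
    rewrite [leLHS](_ : _ = e' / 4 * (r ^+ 2 / (r ^+ 2 + 1))); last first.
      by field; rewrite gt_eqF.
    by rewrite ler_piMr ?divr_ge0 ?(ltW e0') // ler_pdivrMr // mul1r lerDl.
  by move: S2P h4 => /=; lra.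
- move=> u uP T e' sT e0'.
  have [|k Kk kP] := uP (e' / 4); first by rewrite divr_gt0.
  have [||S sS SP] := Kk T (e' / 4) => //; first by rewrite divr_gt0.
  exists S => //.
  have -> : S (T u) = S (T (u - k)) + S (T k).
    rewrite (linear_mapB _ _ (sh_linear sT)) (linear_mapB _ _ (sh_linear sS)).
    by rewrite subrK.
  apply: (le_trans (hf_sqrD hB2 _ _)).
  have h1 := le_trans (sh_le sS _) (le_trans (sh_le sT _) kP).
  by move: h1 SP; lra.
move=> h x Gh T e' sT e0'.
have [g Gg ->] := sh_mod sT (GA Gh).1 (GA Gh).2.
by rewrite -pair_appB; apply: range_small => //; exact: linear_subspaceB.
Qed.



Lemma small_finite (vs : seq (H * H)) e : (forall v, v \in vs -> G_span v) ->
  0 < e -> exists2 S, shrinking S & forall v, v \in vs -> B2 (S v) (S v) <= e.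
Proof.
move=> vsP e0; elim: vs vsP => [|u vs IH] vsP.
  by exists id => //; exact: shrinking_id.
have [|S sS SP] := IH; first by move=> v vvs; apply: vsP; rewrite inE vvs orbT.
have [|T sT TP] := @span_small u S e _ sS e0.
  by apply: vsP; rewrite mem_head.
exists (T \o S); first exact: shrinking_comp.
move=> v; rewrite inE => /predU1P[-> //|/SP]; exact: le_trans (sh_le sT _).
Qed.

(** Total boundedness of the image of the unit ball. *)
Lemma compact_net (f : bop H) e : compact_operator f -> 0 < e ->
  exists vs : seq H, forall x, `|x| <= 1 ->
  exists2 v, v \in vs & rip ip (f x - v) (f x - v) <= e.
Proof.
rewrite /compact_operator precompactE => + e0; set C := closure _.
have r0 : 0 < Num.sqrt e by rewrite sqrtr_gt0.
rewrite compact_cover => cover.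
have [v _|v _|D _ DP] :=
  cover H setT (fun v => interior (ball v (Num.sqrt e)%:C)).
- exact: open_interior.
- by exists v => //; apply: nbhsx_ballx; rewrite ltcR.
exists (finmap.enum_fset D) => x x1.
have [|v vD] := DP (f x); first by apply: subset_closure; exists x.
move=> /interior_subset; rewrite -ball_normE /= => /ltW.
rewrite -normrN opprB (norm_rip ip_norm) // ?(ltW r0) //.
rewrite sqr_sqrtr ?(ltW e0) // => fv.
by exists v.
Qed.

Lemma compact_pair_net b e : compact_operator b.1 -> compact_operator b.2 ->
  0 < e -> exists vs : seq (H * H), forall x, `|x| <= 1 ->
  exists2 v, v \in vs & B2 (pair_app b x - v) (pair_app b x - v) <= e.
Proof.
move=> c1 c2 e0; have e20 : 0 < e / 2 by rewrite divr_gt0.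
have [s sP] := compact_net c1 e20; have [t tP] := compact_net c2 e20.
exists [seq (v, w) | v <- s, w <- t] => x x1.
have [v vs vP] := sP x x1; have [w wt wP] := tP x x1.
exists (v, w); first exact: allpairs_f.
rewrite [leRHS](_ : e = e / 2 + e / 2); last by field.
exact: lerD.
Qed.

Lemma projection_exists v :
  exists p, G_span p /\ forall k, G_span k -> B2 (v - p) k = 0.
Proof.
have [p ? ?] := projection_subspace hB2 v G_span_subspace G_span_hclosed.
by exists p.
Qed.

(** The orthogonal projection onto [G_span]. *)
Definition G_proj v := projT1 (cid (projection_exists v)).

Lemma G_proj_span v : G_span (G_proj v).
Proof. by rewrite /G_proj; case: cid => p []. Qed.

Lemma G_proj_orth v k : G_span k -> B2 (v - G_proj v) k = 0.
Proof. by rewrite /G_proj; case: cid => p [] ? h /= /h. Qed.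

Lemma G_proj_unique v p : G_span p -> (forall k, G_span k -> B2 (v - p) k = 0) ->
  p = G_proj v.
Proof.
move=> ps po; apply/eqP; rewrite -subr_eq0; apply/eqP/(hf_eq0 hB2).
have ds : G_span (p - G_proj v).
  by apply: (linear_subspaceB G_span_subspace) => //; exact: G_proj_span.
have E : p - G_proj v = (v - G_proj v) - (v - p).
  by rewrite opprB [RHS]addrC addrA subrK.
rewrite {1}E.
by rewrite (hfDl hB2) (hfNl hB2) G_proj_orth // po // subrr.
Qed.

Lemma G_proj_linear : linear G_proj.
Proof.
move=> c x y; apply/esym/G_proj_unique.
  by apply: (G_span_subspace.2); exact: G_proj_span.
move=> k ks; rewrite opprD addrACA -scalerBr (hfDl hB2) (hf_conj hB2).
by rewrite !G_proj_orth ?addr0 //; exact: (linear_subspaceZ G_span_subspace).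
Qed.

Lemma G_proj_le v : B2 (G_proj v) (G_proj v) <= B2 v v.
Proof.
have := G_proj_orth v (G_proj_span v); have := hf_ge0 hB2 (v - G_proj v).
rewrite !(hfDl hB2, hfDr hB2, hfNl hB2, hfNr hB2) (hfC hB2 (G_proj v) v); lra.
Qed.

Lemma G_proj_perp v : G_perp (v - G_proj v).
Proof. by move=> h x Gh; rewrite (hfC hB2) G_proj_orth //; exact: G_span_app. Qed.

Section Decompose.
Variable b : bop H * bop H.
Hypotheses (Ab1 : A b.1) (Ab2 : A b.2).
Hypotheses (c1 : compact_operator b.1) (c2 : compact_operator b.2).

(** Compactness of [b] makes the approximation uniform on the unit ball: a
    single [S] that is small on a finite net is small on the whole image, and
    [b - S b] is an element of [G] close to the projection of [b]. *)
Lemma G_proj_approx e : 0 < e -> exists2 g, G g & forall x, `|x| <= 1 ->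
  B2 (G_proj (pair_app b x) - pair_app g x)
     (G_proj (pair_app b x) - pair_app g x) <= e.
Proof.
move=> e0; have e4 : 0 < e / 4 by rewrite divr_gt0.
have [vs vsP] := compact_pair_net c1 c2 e4.
have [|S sS SP] := @small_finite (map G_proj vs) (e / 4) _ e4.
  by move=> _ /mapP[v _ ->]; exact: G_proj_span.
have [g Gg gP] := sh_mod sS Ab1 Ab2.
exists g => // x /vsP[v vvs vP].
have -> : G_proj (pair_app b x) - pair_app g x = S (G_proj (pair_app b x)).
  have := gP x; have := sh_perp sS (@G_proj_perp (pair_app b x)).
  rewrite (linear_mapB _ _ (sh_linear sS)) => h1 h2.
  have -> : pair_app g x = pair_app b x - S (pair_app b x) by rewrite h2 subKr.
  rewrite opprB addrA; move/eqP: h1; rewrite subr_eq => /eqP ->.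
  by rewrite addrA [X in X + _ - _]addrC subrK addrC addKr.
have -> : S (G_proj (pair_app b x)) =
    S (G_proj (pair_app b x - v)) + S (G_proj v).
  rewrite (linear_mapB _ _ G_proj_linear) (linear_mapB _ _ (sh_linear sS)).
  by rewrite subrK.
apply: (le_trans (hf_sqrD hB2 _ _)).
have h1 := le_trans (sh_le sS _) (le_trans (G_proj_le _) vP).
have h2 := SP _ (map_f G_proj vvs).
by move: h1 h2; lra.
Qed.

Let Pb1 x := (G_proj (pair_app b x)).1.
Let Pb2 x := (G_proj (pair_app b x)).2.

Let Pb_le : exists2 M, 0 < M &
  forall x, B2 (G_proj (pair_app b x)) (G_proj (pair_app b x)) <= M * rip ip x x.
Proof.
have [M1 M10 M1P] := bop_rip_bounded ip_norm b.1.
have [M2 M20 M2P] := bop_rip_bounded ip_norm b.2.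
exists (M1 + M2) => [|y]; first exact: addr_gt0.
apply: (le_trans (G_proj_le _)); rewrite mulrDl.
by apply: lerD; [exact: M1P|exact: M2P].
Qed.

Let Pb1_bounded : Pb1 \in @bounded_linear R H.
Proof.
have [M M0 MP] := Pb_le.
apply: (bounded_linear_rip ip_norm (M := M)) => [c x y|x].
  by rewrite /Pb1 pair_app_linear G_proj_linear.
by apply: le_trans (MP x); rewrite lerDl (hf_ge0 hB).
Qed.

Let Pb2_bounded : Pb2 \in @bounded_linear R H.
Proof.
have [M M0 MP] := Pb_le.
apply: (bounded_linear_rip ip_norm (M := M)) => [c x y|x].
  by rewrite /Pb2 pair_app_linear G_proj_linear.
by apply: le_trans (MP x); rewrite lerDr (hf_ge0 hB).
Qed.

(** A closed submodule [G] of the direct sum of two copies of [A] is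
    complemented: the projection [p] of [b] onto [G] is in [G], and [b - p] is
    orthogonal to [G] for the [A]-valued inner product. *)
Theorem closed_submodule_complemented : exists2 p, G p & forall h, G h ->
  bop_adj ip h.1 * (b.1 - p.1) + bop_adj ip h.2 * (b.2 - p.2) = 0.
Proof.
pose p : bop H * bop H := (Bop Pb1_bounded, Bop Pb2_bounded).
have pE x : pair_app p x = G_proj (pair_app b x).
  by rewrite /pair_app /= /Pb1 /Pb2; case: (G_proj _).
exists p; last first.
  move=> h Gh; apply: bopP => x; apply: (rip_ext ip_norm) => y.
  rewrite -[X in rip ip y X]/(pair_adj h (pair_app b x - pair_app p x)).
  by rewrite pE -pair_adjE (@G_proj_perp (pair_app b x) h y Gh) (hf0r hB).
rewrite (closure_id G).1 // => U /nbhs_ballP[e /= e0 eU].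
have epsE : e = (complex.Re e)%:C by rewrite RRe_real // gtr0_real.
have e0' : 0 < complex.Re e by rewrite -ltcR -epsE.
have e20 : 0 < complex.Re e / 2 by rewrite divr_gt0.
have [|g Gg gP] := @G_proj_approx ((complex.Re e / 2) ^+ 2).
  by rewrite exprn_gt0.
exists g; split => //; apply: eU.
have close (f f' : bop H) : (forall x, `|x| <= 1 ->
    rip ip (f x - f' x) (f x - f' x) <= (complex.Re e / 2) ^+ 2) -> ball f e f'.
  move=> ff'; rewrite -ball_normE /= bop_normE [ltRHS]epsE ltcR.
  apply: (@le_lt_trans _ _ (complex.Re e / 2)); last by lra.
  apply: opnorm_le => x x1; rewrite (norm_rip ip_norm) ?(ltW e20) //.
  exact: ff'.
split; apply: close => x /gP; rewrite -pE; apply: le_trans.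
  by rewrite lerDl (hf_ge0 hB).
by rewrite lerDr (hf_ge0 hB).
Qed.

End Decompose.

End Complement.

(** * Closed semiregular operators *)

Section Regularity.
Context (R : realType) (H : completeNormedModType R[i]).
Variable ip : {dot H for @Num.conj R[i]}.
Hypothesis ip_norm : forall x : H, `|x| ^+ 2 = ip x x.

(** By continuity of left multiplication. *)
Lemma mul_closure_eq0 (D : set (bop H)) (f c : bop H) :
  (forall y, D y -> f * y = 0) -> closure D c -> f * c = 0.
Proof.
move=> fD Dc; apply: bopP => x /=; apply/eqP/contraT; rewrite -normr_gt0 => v0.
have [M M0 fM] := bop_bounded f.
set v := `|f (c x)| in v0.
have m0 : 0 < M * `|x| + 1 by rewrite ltr_wpDl // mulr_ge0.
have [y [Dy]] := Dc _ (nbhsx_ballx c (v / (M * `|x| + 1)) (divr_gt0 v0 m0)).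
rewrite -ball_normE /= => cy.
have : v <= M * (`|c - y| * `|x|).
  have -> : v = `|f ((c - y) x)|.
    have fy : f (y x) = 0 by rewrite -[LHS]/((f * y) x) fD.
    have -> : f ((c - y) x) = f (c x) - f (y x) by exact: linearB.
    by rewrite fy subr0.
  apply: (le_trans (fM _)); rewrite ler_wpM2l // bop_normE; exact: le_opnorm.
rewrite mulrCA => h.
have := le_trans h (ler_wpM2r (mulr_ge0 M0 (normr_ge0 x)) (ltW cy)).
rewrite mulrAC ler_pdivlMr // mulrDr mulr1 gerDl => v0'.
by have := lt_le_trans v0 v0'; rewrite ltxx.
Qed.

Lemma dense_annihilator (A D : set (bop H)) (w : bop H) :
  dense_in A D -> A w -> (forall y, D y -> bop_adj ip w * y = 0) -> w = 0.
Proof.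
move=> DA /DA wD /mul_closure_eq0 h.
by apply: (bop_adjMself_eq0 ip_norm); exact: h.
Qed.

Section Operator.
Context (A : set (bop H)) (T : partial_op (bop H)).
Hypothesis A_cstar : cstar_subalgebra ip A.

Let A_sub : linear_subspace A := submod_closed_subspace (cstar_linear A_cstar).

Lemma adjoint_spec_unique y z z' : dense_in A (pdom T) ->
  adjoint_spec ip A T y z -> adjoint_spec ip A T y z' -> z = z'.
Proof.
move=> DA [Az zP] [Az' zP']; apply/eqP; rewrite -subr_eq0; apply/eqP.
apply: (dense_annihilator DA) => [|x Dx]; first exact: linear_subspaceB.
rewrite -[LHS](bop_adjK ip_norm) (bop_adjM ip_norm) (bop_adjK ip_norm).
have -> : bop_adj ip x * (z - z') = 0.
  by rewrite mulrBr -[X in X - _](zP x Dx) -[X in _ - X](zP' x Dx) subrr.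
exact: bop_adj0.
Qed.

(** Both sides have the same [A]-valued inner products with the elements of the
    domain of the adjoint, which is dense. *)
Lemma semiregular_mulr x a : semiregular ip A T ->
  pdom T x -> A a -> T (x * a) = T x * a.
Proof.
move=> [Top Td Ti _ Tsd] Dx Aa; apply/eqP; rewrite -subr_eq0; apply/eqP.
apply: (dense_annihilator Tsd).
  apply: linear_subspaceB => //; first by apply: (op_maps Top); exact: Ti.
  by apply: (cstar_mul A_cstar) => //; exact: (op_maps Top).
move=> y [Ay [z [Az zP]]].
rewrite (bop_adjB ip_norm) (bop_adjM ip_norm) mulrBl -mulrA.
rewrite -[X in X - _]/(module_ip ip (T (x * a)) y).
rewrite -[X in _ - _ * X]/(module_ip ip (T x) y) zP ?zP //; last exact: Ti.
by rewrite /module_ip (bop_adjM ip_norm) mulrA subrr.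
Qed.

End Operator.

End Regularity.

Unset Implicit Arguments.
Set Strict Implicit.
Set Printing Implicit Defensive.

Theorem theorem5p8 (R : realType) (H : completeNormedModType R[i])
  (ip : {dot H for @Num.conj R[i]})
  (ip_norm : forall x : H, `|x| ^+ 2 = ip x x)
  (H_separable : exists2 S : set H, countable S & dense S)
  (A : set (bop H))
  (A_cstar : cstar_subalgebra ip A)
  (A_compact : forall a : bop H, A a -> compact_operator a)
  (T : partial_op (bop H))
  (T_semiregular : semiregular ip A T)
  (T_closed : op_closed T) :
  regular ip A T.
Proof.
split=> // a Aa; apply: subset_closure.
have [Top Td Ti _ _] := T_semiregular.
have A_sub := submod_closed_subspace (cstar_linear A_cstar).
have D_sub := submod_closed_subspace (op_domL Top).
(* project (a, 0) onto the graph of T *)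
have [|||p [Dp pE] pP] := @closed_submodule_complemented
  _ _ _ ip_norm _ A_cstar (pgraph T) _ _ _
  T_closed (a, 0) Aa A_sub.1 (A_compact _ Aa) (A_compact _ A_sub.1).
- split=> [|c x y [Dx xE] [Dy yE]].
    split=> /=; first exact: D_sub.1.
    have := op_linear Top (-1) D_sub.1 D_sub.1.
    by rewrite scaler0 addr0 scaleN1r addNr.
  by split; [exact: D_sub.2 | rewrite /= xE yE (op_linear Top)].
- move=> h [Dh ->]; split; first exact: (op_domS Top).
  exact: (op_maps Top).
- move=> h b [Dh hE] Ab; split => /=; first exact: Ti.
  by rewrite hE (semiregular_mulr ip_norm A_cstar T_semiregular).
(* orthogonality of (a, 0) - p to the graph: T^* (T p.1) = a - p.1 *)
have spec : adjoint_spec ip A T (T p.1) (a - p.1).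
  split; first by apply: linear_subspaceB => //; exact: (op_domS Top).
  move=> x Dx; have /= := pP (x, T x) (conj Dx erefl).
  rewrite pE sub0r mulrN => /eqP; by rewrite subr_eq0 => /eqP/esym.
have Dadj : pdom (op_comp (op_adj ip A T) T) p.1.
  split=> //; split; first exact: (op_maps Top).
  by exists (a - p.1).
exists p.1 => //=.
have -> : xget 0 [set z | adjoint_spec ip A T (T p.1) z] = a - p.1.
  case: xgetP => [z _ zP|/(_ _ spec) //].
  exact: (adjoint_spec_unique ip_norm A_cstar Td zP spec).
by rewrite addrC subrK.
Qed.
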